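(* Let $p$ be a prime and $n$ a positive integer with $\gcd(n,p)=1$. Let $h(x)\in\mathbb{Z}_{p^2}[x]$ be a monic polynomial of degree $2$ dividing $x^n-1$ in $\mathbb{Z}_{p^2}[x]$, and let $\bar h\in\mathbb{F}_p[x]$ be its reduction modulo $p$. Let $C_2$ be the free cyclic code of length $n$ and rank $2$ over $\mathbb{Z}_{p^2}$ with check polynomial $h$, and let $C_1$ be the cyclic code of length $n$ and dimension $2$ over $\mathbb{F}_p$ with check polynomial $\bar h$. Assume that $C_1$ is a two-weight MDS code and that its length $n$ is at most $p+1$. Then $$A_{n-1}(C_1)=n(p-1),\qquad A_n(C_1)=(p-1)(p-n+1),$$ and $$A_{n-1}(C_2)=n(p^2-1),\qquad A_n(C_2)=(p^2-1)(p^2-n+1).$$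
   Context: Here $\mathbb{Z}_{p^2}=\mathbb{Z}/p^2\mathbb{Z}$. For $R=\mathbb{F}_p$ or $R=\mathbb{Z}_{p^2}$, the (free) cyclic code of length $n$ over $R$ with check polynomial $h$ (a monic divisor of $x^n-1$ in $R[x]$) is the ideal of $R[x]/(x^n-1)$ generated by $g=(x^n-1)/h$; it is viewed as a submodule of $R^n$ by identifying a polynomial with its coefficient vector. The Hamming weight of a vector is its number of nonzero coordinates, and $A_w(C)$ is the number of codewords of $C$ of Hamming weight $w$. A linear code over $\mathbb{F}_p$ is two-weight if its nonzero codewords take exactly two distinct Hamming weights. A linear code of length $n$, dimension $\kappa$ and minimum distance $n-\kappa+1$ is called MDS. *)

(* Defs.v *)
From HB Require Import structures.
From mathcomp Require Import all_boot all_order all_algebra.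

Set Implicit Arguments.
Unset Strict Implicit.
Unset Printing Implicit Defensive.

Import GRing.Theory.
Local Open Scope ring_scope.

(* For n > 0 the polynomial 'X^n - 1 is monic of size n.+1 > 1, so that
   {poly %/ 'X^n - 1} really is the quotient ring R[x]/(x^n - 1); its elements
   are the remainders of size <= n, whose coefficients are read off by poly_rV.
   The quotient rdivp ('X^n - 1) h is the exact one when h is a monic divisor
   of 'X^n - 1. *)
Definition cyclic_code (R : finComNzRingType) (n : nat) (h : {poly R}) :
    {set 'rV[R]_n} :=
  let g := in_qpoly ('X^n - 1) (Pdiv.Ring.rdivp ('X^n - 1) h) in
  [set (poly_rV (a * g : {poly %/ 'X^n - 1}) : 'rV[R]_n)
     | a : {poly %/ 'X^n - 1}].

Definition hweight (R : nzRingType) (n : nat) (v : 'rV[R]_n) : nat :=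
  #|[set i | v 0 i != 0]|.

Definition weight_count (R : finNzRingType) (n : nat) (C : {set 'rV[R]_n})
    (w : nat) : nat :=
  #|[set c in C | hweight c == w]|.

Definition linear_code (R : finNzRingType) (n : nat) (C : {set 'rV[R]_n}) :
    Prop :=
  submod_closed [in C].

Definition two_weight (F : finFieldType) (n : nat) (C : {set 'rV[F]_n}) : Prop :=
  linear_code C /\ size (undup [seq hweight c | c in C :\ 0]) = 2%N.

Definition min_distance (R : finNzRingType) (n : nat) (C : {set 'rV[R]_n})
    (d : nat) : Prop :=
  (exists x y, [/\ x \in C, y \in C, x != y & hweight (x - y) = d]) /\
  (forall x y, x \in C -> y \in C -> x != y -> (d <= hweight (x - y))%N).

(* A linear code is its own span, so \dim <<enum C>> is its dimension. *)
Definition MDS (F : finFieldType) (n : nat) (C : {set 'rV[F]_n}) : Prop :=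
  linear_code C /\ min_distance C (n - \dim <<enum C>>%VS + 1).

Definition mod_p (p : nat) (a : 'Z_(p ^ 2)) : 'F_p := (a : nat)%:R.

Lemma cyclic_code_linear (R : finComNzRingType) (n : nat) (h : {poly R}) :
  linear_code (cyclic_code n h).
Proof.
split=> [|k u v].
  by apply/imsetP; exists 0; rewrite // mul0r raddf0.
move=> /imsetP[a _ ->] /imsetP[b _ ->].
apply/imsetP; exists (in_qpoly _ k%:P * a + b) => //.
rewrite mulrDl -mulrA raddfD -linearZ; congr (poly_rV _ + _).
set x := a * _; have xE : in_qpoly ('X^n - 1) (x : {poly R}) = x.
  exact/val_inj/in_qpoly_small/size_mk_monic.
by rewrite -[in RHS]xE -in_qpolyM mul_polyC in_qpolyZ xE.
Qed.

(* Main.v *)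
(* A nonzero codeword of C1 vanishes at most once, because C1 is MDS of
   dimension 2. This lifts to C2: if a codeword b *m G of C2 vanishes at two
   places, its reduction is a codeword of C1 doing so, hence b = p c, and then
   c mod p encodes a codeword of C1 vanishing at the same places, so b = 0.
   In a linear code with q^2 words over a ring of size q, where a nonzero word
   vanishes at most once, any two coordinates parametrize the code; so exactly
   q - 1 nonzero words vanish at a given place, and summing over the n places
   counts the words of weight n - 1. *)
Require Import Defs.
From HB Require Import structures.
From mathcomp Require Import all_boot all_order all_algebra.
From mathcomp Require Import zify.

Set Implicit Arguments.
Unset Strict Implicit.
Unset Printing Implicit Defensive.

Import GRing.Theory.
Local Open Scope ring_scope.

(** * Words of a code counted by weight *)

Lemma hweight_compl (R : nzRingType) (n : nat) (v : 'rV[R]_n) :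
  (hweight v + #|[set i | v 0%R i == 0%R]| = n)%N.
Proof.
rewrite -[RHS]card_ord -(cardC [set i | v 0 i != 0]); congr (_ + _)%N.
by apply: eq_card => i; rewrite !inE negbK.
Qed.

Lemma weight_count_sum (R : finNzRingType) (n w : nat) (C : {set 'rV[R]_n}) :
  (0 < w)%N -> weight_count C w = (\sum_(c in C :\ 0%R) (hweight c == w))%N.
Proof.
move=> w_gt0; rewrite /weight_count -sum1_card big_mkcond [RHS]big_mkcond /=.
apply: eq_bigr => c _; rewrite !inE; case: (eqVneq c 0) => [->|_] /=.
  rewrite (_ : hweight 0 = 0)%N ?(gtn_eqF w_gt0) ?andbF //.
    by rewrite eq_sym (gtn_eqF w_gt0) andbF.
  by apply: eq_card0 => i; rewrite !inE mxE eqxx.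
by case: (c \in C); case: eqP.
Qed.

(** Stated over an arbitrary ring so as to serve [C1] with [q = p] and [C2] with [q = p ^ 2]. The
    counts are cast to integers to keep the subtractions from truncating. *)
Lemma weight_count_rank2 (R : finNzRingType) (n q : nat) (C : {set 'rV[R]_n}) :
  #|R| = q -> (1 < n)%N -> linear_code C -> #|C| = (q ^ 2)%N ->
  (forall c (i j : 'I_n), c \in C -> i != j -> c 0 i = 0 -> c 0 j = 0 ->
    c = 0) ->
  (weight_count C n.-1)%:Z = n%:Z * (q%:Z - 1) /\
  (weight_count C n)%:Z = (q%:Z - 1) * (q%:Z - n%:Z + 1).
Proof.
move=> cardR n_gt1 [C0 CZD] cardC Cinj.
have n_gt0 : (0 < n)%N by apply: ltnW.
have CB x y : x \in C -> y \in C -> x - y \in C.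
  by move=> xC yC; rewrite addrC -scaleN1r; apply: CZD.
have zeros_le1 c : c \in C :\ 0 -> (#|[set i | c 0%R i == 0%R]| <= 1)%N.
  rewrite !inE => /andP[c0 cC]; apply/card_le1_eqP => i j.
  rewrite !inE => /eqP ci /eqP cj; apply/eqP; apply: contraNT c0 => ij.
  by apply/eqP/(Cinj _ i j); rewrite // eq_sym.
have card_zero_at i : #|[set c in C | c 0 i == 0]| = q.
  have [j ij] : exists j : 'I_n, i != j.
    have : (0 < #|predC1 i|)%N by rewrite cardC1 card_ord -subn1 subn_gt0.
    by case/card_gt0P=> j; rewrite !inE eq_sym; exists j.
  pose e (c : 'rV[R]_n) := (c 0 i, c 0 j).
  have e_inj : {in C &, injective e}.
    move=> x y xC yC [exi exj]; apply/subr0_eq/(Cinj _ i j) => //.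
    - exact: CB.
    - by rewrite !mxE exi subrr.
    - by rewrite !mxE exj subrr.
  have eC : e @: C = setT.
    apply/eqP; rewrite eqEcard subsetT cardsT card_prod card_in_imset //.
    by rewrite cardC cardR mulnn leqnn.
  (* As [e] maps the code bijectively onto all pairs, the words vanishing at [i] correspond to the
     [q] pairs [(0, b)]. *)
  rewrite -(card_in_imset (f := e)); last first.
    by move=> x y; rewrite !inE => /andP[xC _] /andP[yC _]; apply: e_inj.
  have pair0_inj : injective (fun b : R => (0 : R, b)) by move=> x y [].
  rewrite -cardR -(card_imset predT pair0_inj).
  apply: eq_card => -[a b]; apply/imsetP/imsetP => [[c]|[b' _ [-> ->]]].
    by rewrite inE => /andP[_ /eqP ci] [-> ->]; exists (c 0 j); rewrite ?ci.
  have /imsetP[c cC [ci cj]] : (0, b') \in e @: C by rewrite eC inE.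
  by exists c; rewrite ?inE ?cC -?ci ?eqxx // /e -ci -cj.
have q_gt0 : (0 < q)%N by rewrite -cardR; apply/card_gt0P; exists 0.
have count1 : weight_count C n.-1 = (n * q.-1)%N.
  rewrite weight_count_sum; last by rewrite -ltnS prednK.
  (* A nonzero word has zero or one vanishing coordinate, so the indicator of weight [n.-1] equals
     its number of zeros; the double sum can then be exchanged. *)
  rewrite (eq_bigr (fun c : 'rV_n => \sum_(i < n) (c 0%R i == 0%R)))%N; last first.
    move=> c /zeros_le1; have := hweight_compl c.
    have -> : #|[set i | c 0%R i == 0%R]| = (\sum_(i < n) (c 0%R i == 0%R))%N.
      by rewrite -sum1dep_card big_mkcond; apply: eq_bigr => i _; case: eqP.
    by move: (hweight c) (\sum_(i < n) _)%N => w z; case: eqP; lia.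
  rewrite exchange_big /= -[in RHS](card_ord n) -sum_nat_const.
  apply: eq_bigr => i _.
  rewrite -(card_zero_at i) (cardsD1 0) !inE C0 mxE eqxx /=.
  rewrite -sum1_card big_mkcond [RHS]big_mkcond /=; apply: eq_bigr => c _.
  by rewrite !inE; case: eqP => //=; case: (c \in C) => //=; case: eqP.
(* Each of the [q ^ 2 - 1] nonzero words has weight [n.-1] or [n]. *)
have count2 : (weight_count C n.-1 + weight_count C n = (q ^ 2).-1)%N.
  rewrite !weight_count_sum //; last by rewrite -ltnS prednK.
  rewrite -big_split /=.
  rewrite -cardC (cardsD1 0) C0 /= -sum1_card; apply: eq_bigr => c /zeros_le1.
  have := hweight_compl c; move: (hweight c) #|_| => w z.
  by case: eqP; case: eqP; lia.
rewrite count1 in count2 *.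
case: q {cardC cardR card_zero_at count1} q_gt0 count2 => // r _ count2.
by split; move: count2; rewrite -?mulnn; nia.
Qed.

(** * Cyclic codes as row spaces of the shifts of [g] *)

Definition generator_mx (R : nzRingType) (k n : nat) (g : {poly R}) :
  'M[R]_(k, n) := \matrix_(i < k) poly_rV ('X^i * g).

(** This makes the reduction of the generator matrix of [C2] the generator matrix of [C1]. *)
Lemma map_generator_mx (R S : nzRingType) (f : {rmorphism R -> S}) (k n : nat)
    (g : {poly R}) :
  map_mx f (generator_mx k n g) = generator_mx k n (map_poly f g).
Proof.
apply/row_matrixP => i; rewrite -map_row !rowK map_poly_rV.
by rewrite rmorphM /= map_polyXn.
Qed.

Lemma mulmx_generator (R : nzRingType) (k n : nat) (g : {poly R})
    (b : 'rV[R]_k) :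
  b *m generator_mx k n g = poly_rV (rVpoly b * g).
Proof.
rewrite mulmx_sum_row [in RHS](row_sum_delta b) linear_sum mulr_suml linear_sum.
apply: eq_bigr => i _.
by rewrite rowK linearZ /= rVpoly_delta -scalerAl linearZ.
Qed.

Section CyclicCode.

Variables (R : finComNzRingType) (n : nat) (g h : {poly R}).
Hypotheses (n_gt0 : (0 < n)%N) (h_monic : h \is monic).
Hypothesis gh : 'X^n - 1 = g * h.
Let k := (size h).-1.

Let XnB1_monic : ('X^n - 1 : {poly R}) \is monic.
Proof. by rewrite -polyC1 monicXnsubC. Qed.

Lemma check_cofactor_monic : g \is monic.
Proof.
by have := XnB1_monic; rewrite gh monicMr.
Qed.

Lemma size_check_cofactor : (size g + k = n.+1)%N.
Proof.
have h_gt0 : (0 < size h)%N by rewrite size_poly_gt0 monic_neq0.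
have := size_XnsubC (1 : R) n_gt0; rewrite polyC1 gh.
rewrite size_monicM ?check_cofactor_monic ?monic_neq0 // /k.
by case: (size h) h_gt0 => // m _; rewrite addnS.
Qed.

(** Since [size g + k = n.+1], the product has size at most [n], so [poly_rV] truncates nothing. *)
Lemma rVpoly_generator (b : 'rV[R]_k) :
  rVpoly (b *m generator_mx k n g) = rVpoly b * g.
Proof.
rewrite mulmx_generator poly_rV_K //.
have g_gt0 : (0 < size g)%N.
  by rewrite size_poly_gt0 monic_neq0 ?check_cofactor_monic.
apply: leq_trans (size_polyMleq _ _) _.
rewrite -ltnS prednK ?addn_gt0 ?g_gt0 ?orbT //.
rewrite -size_check_cofactor addnC leq_add2l.
exact: size_poly.
Qed.

(** A monic [g] is regular in R[x], even when R has zero divisors. *)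
Lemma generator_mx_inj :
  injective (fun b : 'rV[R]_k => b *m generator_mx k n g).
Proof.
move=> b b' /(congr1 (@rVpoly _ _)); rewrite !rVpoly_generator.
by move/(monic_rreg check_cofactor_monic)/(can_inj rVpolyK).
Qed.

(** Dividing [a = u * h + r] gives [a * g = u * ('X^n - 1) + r * g], so only the remainder [r], a
    message of length [k], matters. *)
Lemma cyclic_codeE :
  cyclic_code n h = [set b *m generator_mx k n g | b : 'rV[R]_k].
Proof.
have in_qpolyE (a : {poly R}) (b : 'rV[R]_k) :
    Pdiv.Ring.rmodp a h = rVpoly b ->
  poly_rV (in_qpoly ('X^n - 1) (a * g)) = b *m generator_mx k n g.
  move=> ab; rewrite [a](Pdiv.RingMonic.rdivp_eq h_monic) ab mulrDl -mulrA.
  rewrite [h * g]mulrC -gh -rVpoly_generator /= /mk_monic.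
  rewrite -polyC1 size_XnsubC // ltnS n_gt0 XnB1_monic /=.
  rewrite Pdiv.RingMonic.rmodp_addl_mul_small ?rVpolyK //.
  by rewrite size_XnsubC // ltnS size_poly.
rewrite /cyclic_code [X in in_qpoly _ (Pdiv.Ring.rdivp X h)]gh.
rewrite Pdiv.RingMonic.rdivp_mull //.
apply/setP=> v; apply/imsetP/imsetP => [] [a _ ->].
  exists (poly_rV (Pdiv.Ring.rmodp (a : {poly R}) h)) => //.
  rewrite -(in_qpolyE a); last first.
    rewrite poly_rV_K // -ltnS prednK ?size_poly_gt0 ?monic_neq0 //.
    by rewrite Pdiv.Ring.ltn_rmodpN0 ?monic_neq0.
  rewrite in_qpolyM; congr (poly_rV (polyn (_ * _))).
  exact/esym/val_inj/in_qpoly_small/size_mk_monic.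
exists (in_qpoly _ (rVpoly a)) => //.
rewrite -in_qpolyM (in_qpolyE _ a) // Pdiv.Ring.rmodp_small //.
by rewrite -[X in (_ < X)%N]prednK ?ltnS ?size_poly ?size_poly_gt0 ?monic_neq0.
Qed.

Lemma card_cyclic_code : #|cyclic_code n h| = (#|R| ^ k)%N.
Proof.
by rewrite cyclic_codeE (card_imset _ generator_mx_inj) card_mx mul1n.
Qed.

End CyclicCode.

(** The span of the code is the image of the encoding map [f], which is injective. *)
Lemma dim_cyclic_code (F : finFieldType) (n : nat) (g h : {poly F}) :
  (0 < n)%N -> h \is monic -> 'X^n - 1 = g * h ->
  \dim <<enum (cyclic_code n h)>>%VS = (size h).-1.
Proof.
move=> n_gt0 h_monic gh; set k := (size h).-1.
pose f : 'Hom('rV[F]_k, 'rV[F]_n) := linfun (mulmxr (generator_mx k n g)).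
have fE b : f b = b *m generator_mx k n g by rewrite lfunE.
have -> : <<enum (cyclic_code n h)>>%VS = limg f.
  apply/eqP; rewrite eqEsubv; apply/andP; split.
    apply/span_subvP => v; rewrite mem_enum (cyclic_codeE n_gt0 h_monic gh).
    by case/imsetP=> b _ ->; rewrite -fE memv_img ?memvf.
  apply/subvP => v /memv_imgP[b _ ->]; apply: memv_span.
  by rewrite mem_enum (cyclic_codeE n_gt0 h_monic gh) fE; apply: imset_f.
rewrite limg_dim_eq; first by rewrite dimvf /dim /= mul1n.
rewrite capfv; apply/eqP/lker0P => b b'; rewrite !fE.
exact: (generator_mx_inj n_gt0 h_monic gh).
Qed.

(** * Reduction from Z/p^2 to F_p and lifting of injectivity *)

Section Reduction.

Variable p : nat.
Hypothesis p_prime : prime p.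

Let p_gt0 : (0 < p)%N := prime_gt0 p_prime.
Let p2_gt1 : (1 < p ^ 2)%N.
Proof. by rewrite (ltn_exp2l 0) ?prime_gt1. Qed.

(** Because p divides p^2, the choice of representative is immaterial. Every residue is a numeral,
    so the morphism laws below reduce to those of natural numbers. *)
Lemma mod_p_nat (m : nat) : mod_p (m%:R : 'Z_(p ^ 2)) = m%:R.
Proof.
rewrite /mod_p val_Zp_nat //; apply: val_inj.
by rewrite /= !val_Fp_nat // modn_dvdm // dvdn_mulr.
Qed.

Lemma mod_p_is_zmod_morphism : zmod_morphism (@mod_p p).
Proof.
suff modD : {morph @mod_p p : a b / a + b}.
  by move=> a b; apply/eqP; rewrite eq_sym subr_eq -modD subrK.
move=> a b; rewrite -[a]natr_Zp -[b]natr_Zp -natrD !mod_p_nat.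
by rewrite natrD.
Qed.

Lemma mod_p_is_monoid_morphism : monoid_morphism (@mod_p p).
Proof.
split; first exact: (mod_p_nat 1).
by move=> a b; rewrite -[a]natr_Zp -[b]natr_Zp -natrM !mod_p_nat natrM.
Qed.

Definition mod_p_rmorphism : {rmorphism 'Z_(p ^ 2) -> 'F_p} :=
  HB.pack (@mod_p p)
    (GRing.isZmodMorphism.Build _ _ _ mod_p_is_zmod_morphism)
    (GRing.isMonoidMorphism.Build _ _ _ mod_p_is_monoid_morphism).

Lemma mod_p_eq0 (a : 'Z_(p ^ 2)) : (mod_p a == 0) = (p %| a)%N.
Proof. by rewrite -val_eqE /= val_Fp_nat. Qed.

Lemma mod_p_eq0P (a : 'Z_(p ^ 2)) :
  mod_p a = 0 -> a = p%:R * (a %/ p)%:R.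
Proof.
by move/eqP; rewrite mod_p_eq0 -natrM mulnC => /divnK->; rewrite natr_Zp.
Qed.

(** p^2 divides pa exactly when p divides a: multiplication by p embeds F_p into Z/p^2 as the ideal
    (p). *)
Lemma mulp_eq0 (a : 'Z_(p ^ 2)) : (p%:R * a == 0) = (mod_p a == 0).
Proof.
rewrite mod_p_eq0 -[a in LHS]natr_Zp -natrM -val_eqE /= val_Zp_nat //.
rewrite -[_ == _]/(p ^ 2 %| p * a)%N; move: (a : nat) => m.
by rewrite -mulnn dvdn_pmul2l.
Qed.

Lemma lift_determining (k n : nat) (S : pred 'I_n) (M : 'M['Z_(p ^ 2)]_(k, n)) :
  (forall b : 'rV['F_p]_k,
    (forall j, S j -> (b *m map_mx (@mod_p p) M) 0 j = 0) -> b = 0) ->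
  forall b : 'rV['Z_(p ^ 2)]_k,
    (forall j, S j -> (b *m M) 0 j = 0) -> b = 0.
Proof.
move=> inj b bM0.
have red0 (c : 'rV['Z_(p ^ 2)]_k) :
    (forall j, S j -> mod_p ((c *m M) 0 j) = 0) -> forall i, mod_p (c 0 i) = 0.
  move=> cM0 i; suff /rowP/(_ i) : map_mx (@mod_p p) c = 0 by rewrite !mxE.
  apply: inj => j Sj; rewrite -[@mod_p p]/(mod_p_rmorphism : _ -> _) -map_mxM mxE.
  exact: cM0.
(* The first use of [red0] shows that p divides every entry of [b]; [c] collects the quotients. *)
pose c : 'rV['Z_(p ^ 2)]_k := \row_i (b 0 i %/ p)%:R.
have bE : b = p%:R *: c.
  apply/rowP => i; rewrite !mxE -mod_p_eq0P //; apply: red0 => j Sj.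
  by rewrite bM0 // (mod_p_nat 0).
apply/rowP => i; rewrite bE !mxE; apply/eqP; rewrite mulp_eq0; apply/eqP.
have -> : (b 0 i %/ p)%:R = c 0 i :> 'Z_(p ^ 2) by rewrite mxE.
(* The second use of [red0] is for [c]: p times an entry of [c *m M] is the matching entry of
   [b *m M], which is zero on [S]. *)
apply: red0 => j Sj; apply/eqP; rewrite -mulp_eq0.
by have := bM0 j Sj; rewrite bE -scalemxAl mxE => ->.
Qed.

End Reduction.

Theorem theorem2 (p n : nat) (p_prime : prime p) (n_gt0 : (0 < n)%N)
    (co_np : coprime n p) (h : {poly 'Z_(p ^ 2)})
    (h_monic : h \is monic) (h_deg2 : size h = 3%N)
    (h_dvd : exists q : {poly 'Z_(p ^ 2)}, 'X^n - 1 = q * h) :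
  let C2 := cyclic_code n h in
  let C1 := cyclic_code n (map_poly (@mod_p p) h) in
  two_weight C1 -> MDS C1 -> (n <= p + 1)%N ->
  ((weight_count C1 n.-1)%:Z = n%:Z * (p%:Z - 1) /\
   (weight_count C1 n)%:Z = (p%:Z - 1) * (p%:Z - n%:Z + 1)) /\
  ((weight_count C2 n.-1)%:Z = n%:Z * (p%:Z ^+ 2 - 1) /\
   (weight_count C2 n)%:Z = (p%:Z ^+ 2 - 1) * (p%:Z ^+ 2 - n%:Z + 1)).
Proof.
move=> C2 C1 _ [_ [_ distC1]] _; case: h_dvd => g gh.
pose f := mod_p_rmorphism p_prime; set hb := map_poly (@mod_p p) h in C1 distC1 *.
pose gb := map_poly f g.
have p2_gt1 : (1 < p ^ 2)%N by rewrite (ltn_exp2l 0) ?prime_gt1.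
have ghb : 'X^n - 1 = gb * hb.
  rewrite -[hb]/(map_poly f h) -rmorphM -gh rmorphB rmorphXn rmorph1 /=.
  by rewrite (map_polyX f).
have hb_monic : hb \is monic by apply: (monic_map f).
have size_hb : size hb = 3%N.
  rewrite -h_deg2; apply: (size_map_poly_id0 (f := f)).
  by rewrite (monicP h_monic) rmorph1 oner_eq0.
(* The cofactor [gb] is nonzero and [n = size gb + 1]. *)
have n_gt1 : (1 < n)%N.
  have := size_check_cofactor n_gt0 hb_monic ghb; rewrite size_hb addn2 => -[<-].
  rewrite ltnS size_poly_gt0 monic_neq0 //.
  exact: check_cofactor_monic n_gt0 hb_monic ghb.
have inj1 (c : 'rV_n) (i j : 'I_n) :
    c \in C1 -> i != j -> c 0 i = 0 -> c 0 j = 0 -> c = 0.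
  move=> cC ij ci cj; apply/eqP/negPn/negP => c_neq0.
  have C1_0 : 0 \in C1 by case: (cyclic_code_linear n hb).
  (* In dimension 2 the MDS distance is [n - 1], whereas two zeros leave weight at most [n - 2]. *)
  have := distC1 _ _ cC C1_0 c_neq0; rewrite subr0.
  rewrite (dim_cyclic_code n_gt0 hb_monic ghb) size_hb /=.
  have : (#|[set i; j]| <= #|[set i | c 0%R i == 0%R]|)%N.
    apply/subset_leq_card/subsetP => l.
    by rewrite !inE => /orP[] /eqP->; apply/eqP.
  have := hweight_compl c; rewrite cards2 ij.
  by move: (hweight c) #|_| => w z; lia.
have inj2 (c : 'rV_n) (i j : 'I_n) :
    c \in C2 -> i != j -> c 0 i = 0 -> c 0 j = 0 -> c = 0.
  rewrite /C2 (cyclic_codeE n_gt0 h_monic gh) => /imsetP[b _ ->] ij bi bj.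
  suff -> : b = 0 by rewrite mul0mx.
  apply: (lift_determining p_prime (S := pred2 i j)) => [d dM0|l]; last first.
    by case/pred2P=> ->; [exact: bi | exact: bj].
  have dM0' l : l \in [:: i; j] -> (d *m generator_mx _ n gb) 0 l = 0.
    rewrite !inE -map_generator_mx; exact: dM0.
  (* The message length in the type of [d] comes from [size h]; it must be restated through
     [size hb] before the injectivity for [gb] applies. *)
  move: d {dM0} dM0'; rewrite h_deg2 -size_hb => d dM0.
  apply: (generator_mx_inj n_gt0 hb_monic ghb); rewrite mul0mx.
  apply: (inj1 _ i j) => //; last 2 first.
  - by apply: dM0; rewrite !inE eqxx.
  - by apply: dM0; rewrite !inE eqxx orbT.
  by rewrite /C1 (cyclic_codeE n_gt0 hb_monic ghb); apply: imset_f.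
split.
  apply: weight_count_rank2 inj1 => //; first exact: card_Fp.
    exact: cyclic_code_linear.
  by rewrite (card_cyclic_code n_gt0 hb_monic ghb) size_hb card_Fp.
have cardZ : #|'Z_(p ^ 2)| = (p ^ 2)%N by rewrite card_ord Zp_cast.
(* The integer square becomes the cast of the natural number [p ^ 2], to match the parameter [q]. *)
have -> : p%:Z ^+ 2 = (p ^ 2)%N by rewrite -mulnn PoszM.
apply: weight_count_rank2 inj2 => //; first exact: cyclic_code_linear.
by rewrite (card_cyclic_code n_gt0 h_monic gh) h_deg2 cardZ.
Qed.
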